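(* Let $k\ge 3$ and $\ell\ge 2$ be integers and let $\mathcal N=\{N_1,\ldots,N_\ell\}$ be a collection of $k$-element sets, with $V=\bigcup_{i=1}^\ell N_i$, $n=|V|$ and $m=n-k$. Assume: (i) $\bigcap_{i=1}^\ell N_i=\varnothing$, but $\bigcap_{j\ne i}N_j\neq\varnothing$ for every $i=1,\ldots,\ell$; (ii) for every $S\subseteq V$ with $|S|\ge k+1$ there is a $3$-element set $T\subseteq S$ such that $T\not\subseteq N_i$ for all $i=1,\ldots,\ell$. Then $$n\le \binom{m+2}{2}+6m^{5/3}+3m^{4/3}+9m-3.$$
   Context: Condition (i) says the family is minimal with respect to having empty intersection; condition (ii) says that in the $3$-uniform hypergraph on $V$ whose edges are all $3$-subsets of the sets $N_i$, every clique has at most $k$ vertices. *)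

(* Defs.v *)
From mathcomp Require Import all_boot all_order all_algebra.
From mathcomp Require Import all_classical all_reals all_analysis.
Set Implicit Arguments. Unset Strict Implicit. Unset Printing Implicit Defensive.

(* Main.v *)
Require Import Defs.
From mathcomp Require Import all_boot all_order all_algebra.
From mathcomp Require Import all_classical all_reals all_analysis.
From mathcomp Require Import fintype finset ring lra zify.
Import Order.TTheory GRing.Theory Num.Theory.
Set Implicit Arguments.
Unset Strict Implicit.
Unset Printing Implicit Defensive.

(**
Put [B_i = V \ N_i], a family of [m]-sets covering [V].  Call a triple an edge
if it meets every [B_i]; by (ii) every set whose complement in [V] has fewer
than [m] elements contains an edge.

Following Szemeredi and Petruska, repeatedly choose a minimal subfamily of the
current [B_i] that still covers the vertices not used so far, and put a private
vertex of each of its members [B_i] into a set [X_i].  This gives disjoint sets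
[X_i] included in [B_i] such that [X_i] misses [B_j] whenever
[#|X_i| <= #|X_j|].  Stopping just before a subfamily has at most three
members, all but [3m] vertices lie in some [X_i].

If [#|D| < #|X_i|], the complement of [(B_i \ X_i) u D] contains an edge, whose
part outside [X_i] is at most a pair, avoids [B_i u D], and meets [B_j] for all
[j != i] with [#|X_j| >= #|X_i|].  Choosing [D] greedily produces about
[#|X_i|] pairs for each [i], each disjoint from a set
[(B_i \ X_i) u D] of size less than [m], and the skew Bollobas inequality for
(2, m-1)-set pairs bounds the total number by [binom(m+1, 2)].  The deleted
elements of [X_i] matter only for pairs [{x, y}] with [x] in [X_i]; then [y]
lies in all but at most two of the [B_p] with [#|X_p| >= #|X_i|].  Such popular
vertices are put into [D] in advance, which costs at most [6m] pairs in total.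
Hence [n <= binom(m+1, 2) + 9m].
*)

(** * Skew Bollobas inequality for pairs, by polynomials *)

Definition hits (T : finType) (p : T * T) (B : {set T}) : bool :=
  (p.1 \in B) || (p.2 \in B).

(** Counts the monomials of degree at most [b] in two variables, the dimension bound in
    [skew_bollobas]. *)
Lemma card_ord_pairs_sum (b : nat) :
  #|[pred p : 'I_b.+1 * 'I_b.+1 | p.1 + p.2 <= b]| = 'C(b.+2, 2).
Proof.
rewrite -sum1_card.
rewrite -(pair_big_dep xpredT (fun i j : 'I_b.+1 => i + j <= b) (fun _ _ => 1)) /=.
rewrite -bin2_sum big_mkord big_ord_recl add0n (reindex_inj rev_ord_inj) /=.
apply: eq_bigr => i _; rewrite sum1_card.
rewrite (eq_card (B := [pred j : 'I_b.+1 | j < i.+1])); last first.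
  by move=> j; rewrite !inE; have := ltn_ord i; lia.
rewrite -sum1_card -(big_ord_widen b.+1 (fun=> 1)) ?ltn_ord //.
by rewrite sum1_card card_ord.
Qed.

Local Open Scope ring_scope.

(** Only [d] bounds the degree; [b] fixes the range of the sums, so that the index type stays the
    same as factors are multiplied in. *)
Definition total_degree_le (b d : nat) (g : rat -> rat -> rat) : Prop :=
  exists2 a : nat -> nat -> rat,
    forall i j, (d < i + j)%N -> a i j = 0 &
    forall x y, g x y = \sum_(i < b.+1) \sum_(j < b.+1) a i j * x ^+ i * y ^+ j.

Lemma sum_exp_shift (b : nat) (f : nat -> rat) (y : rat) : f b = 0 ->
  y * (\sum_(j < b.+1) f j * y ^+ j) =
  \sum_(j < b.+1) (if j : nat is j'.+1 then f j' else 0) * y ^+ j.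
Proof.
move=> fb; rewrite big_ord_recr /= fb mul0r addr0 big_ord_recl /= mul0r add0r.
by rewrite mulr_sumr; apply: eq_bigr => j _; rewrite /= exprS mulrCA.
Qed.

Lemma total_degree_le_mul (b d : nat) (g : rat -> rat -> rat) (u v : rat) :
  (d < b)%N -> total_degree_le b d g ->
  total_degree_le b d.+1 (fun x y => (u - x * v + y) * g x y).
Proof.
move=> db [a a0 ga].
exists (fun i j => u * a i j - v * (if i is i'.+1 then a i' j else 0)
   + (if j is j'.+1 then a i j' else 0)).
  move=> i j ij; rewrite a0; last by lia.
  case: i ij => [|i] ij; case: j ij => [|j] ij; rewrite ?a0 ?mulr0 ?subr0 ?addr0 //; lia.
move=> x y.
have Ex : x * g x y = \sum_(i < b.+1) \sum_(j < b.+1)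
    (if i : nat is i'.+1 then a i' j else 0) * x ^+ i * y ^+ j.
  rewrite ga exchange_big /= [RHS]exchange_big /= mulr_sumr.
  apply: eq_bigr => j _; rewrite -mulr_suml mulrA (@sum_exp_shift b (a^~ j)); last first.
    by rewrite a0 //; lia.
  by rewrite mulr_suml.
have Ey : y * g x y = \sum_(i < b.+1) \sum_(j < b.+1)
    (if j : nat is j'.+1 then a i j' else 0) * x ^+ i * y ^+ j.
  rewrite ga mulr_sumr; apply: eq_bigr => i _.
  have E (h : nat -> rat) : \sum_(j < b.+1) h j * x ^+ i * y ^+ j
      = x ^+ i * \sum_(j < b.+1) h j * y ^+ j.
    by rewrite mulr_sumr; apply: eq_bigr => j _; ring.
  rewrite E (E (fun j => if j is j'.+1 then a i j' else 0)).
  rewrite mulrCA (@sum_exp_shift b (a i)) // a0 //; lia.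
have -> : (u - x * v + y) * g x y = u * g x y - v * (x * g x y) + y * g x y by ring.
rewrite Ex Ey ga !mulr_sumr -sumrB -big_split /=; apply: eq_bigr => i _.
rewrite !mulr_sumr -sumrB -big_split /=; apply: eq_bigr => j _; ring.
Qed.

Lemma total_degree_le_prod (V : Type) (c : V -> rat) (b : nat) (s : seq V) :
  (size s <= b)%N ->
  total_degree_le b (size s)
    (fun x y => \prod_(v <- s) (c v ^+ 2 - x * c v + y)).
Proof.
elim: s => [|v s IHs] /= sb.
  exists (fun i j => ((i == 0) && (j == 0))%N%:R) => [[|i] [|j]|x y] //.
  rewrite big_nil big_ord_recl big_ord_recl /= !mulr1 !big1 ?addr0 // => i _.
    by rewrite big1 // => j _; rewrite !mul0r.
  by rewrite !mul0r.
have [a a0 E] := total_degree_le_mul (c v ^+ 2) (c v) sb (IHs (ltnW sb)).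
by exists a => // x y; rewrite big_cons E.
Qed.

(* The polynomials [f B] in two variables have total degree at most [b], and
   [f B] evaluated at the elementary symmetric functions of the labels of a
   pair [p] vanishes iff [p] meets [B]; skewness makes the evaluation matrix
   triangular. *)
Lemma skew_bollobas (T : finType) (b : nat) (s : seq ((T * T) * {set T})) :
  all (fun q => ~~ hits q.1 q.2 && (#|q.2| <= b)%N) s ->
  pairwise (fun p q => hits p.1 q.2) s ->
  (size s <= 'C(b.+2, 2))%N.
Proof.
case: s => [//|q0 s0]; set s := q0 :: s0 => /(all_nthP q0) sA /(pairwiseP q0) sP.
pose c (v : T) : rat := (enum_rank v)%:R.
have c_inj : injective c.
  by move=> u v /eqP; rewrite eqr_nat => /eqP /val_inj /enum_rank_inj.
pose f (B : {set T}) x y := \prod_(v <- enum B) (c v ^+ 2 - x * c v + y).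
pose e1 (p : T * T) := c p.1 + c p.2; pose e2 (p : T * T) := c p.1 * c p.2.
have f0 p B : (f B (e1 p) (e2 p) == 0) = hits p B.
  rewrite /f prodf_seq_eq0; apply/hasP/orP => [[v]|[] pB].
  - rewrite mem_enum /= => vB.
    have -> : c v ^+ 2 - e1 p * c v + e2 p = (c v - c p.1) * (c v - c p.2).
      by rewrite /e1 /e2; ring.
    rewrite mulf_eq0 !subr_eq0 !(inj_eq c_inj).
    by case/orP => /eqP <-; [left | right].
  - by exists p.1; rewrite ?mem_enum //= /e1 /e2; apply/eqP; ring.
  - by exists p.2; rewrite ?mem_enum //= /e1 /e2; apply/eqP; ring.
pose nq (i : 'I_(size s)) := nth q0 s i.
have nqA i : ~~ hits (nq i).1 (nq i).2 /\ (#|(nq i).2| <= b)%N.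
  by apply/andP/sA.
have deg i : exists a : nat -> nat -> rat, (forall i' j', (b < i' + j')%N -> a i' j' = 0)
   /\ forall x y, f (nq i).2 x y = \sum_(i' < b.+1) \sum_(j < b.+1) a i' j * x ^+ i' * y ^+ j.
  have [_ le_b] := nqA i; rewrite cardE in le_b.
  have [a a0 E] := total_degree_le_prod c le_b.
  by exists a; split => // i' j ij; apply: a0; apply: leq_ltn_trans ij.
have [a aP] := fin_all_exists deg.
pose A : {pred 'I_b.+1 * 'I_b.+1} :=
  [pred p : 'I_b.+1 * 'I_b.+1 | (p.1 + p.2 <= b)%N].
pose M : 'M[rat]_(size s) := \matrix_(i, j) f (nq j).2 (e1 (nq i).1) (e2 (nq i).1).
pose P : 'M[rat]_(size s, #|A|) := \matrix_(i, k)
  (e1 (nq i).1 ^+ (@enum_val _ A k).1 * e2 (nq i).1 ^+ (@enum_val _ A k).2).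
pose C : 'M[rat]_(#|A|, size s) := \matrix_(k, j) a j (@enum_val _ A k).1 (@enum_val _ A k).2.
(* Expansion in monomials factors [M] through dimension [#|A|], which bounds its rank. *)
have ME : M = P *m C.
  apply/matrixP => i j; rewrite !mxE; have [a0 ->] := aP j.
  rewrite pair_big /=; set F := fun p : 'I_b.+1 * 'I_b.+1 =>
    e1 (nq i).1 ^+ p.1 * e2 (nq i).1 ^+ p.2 * a j p.1 p.2.
  rewrite (eq_bigr (fun k => F (@enum_val _ A k))); last by move=> k _; rewrite !mxE.
  rewrite -(big_enum_val F) [RHS]big_mkcond /=; apply: eq_bigr => p _.
  rewrite inE /F; case: leqP => [_|/a0 ->]; last by rewrite !mul0r.
  ring.
have Mu : M \in unitmx.
  rewrite unitmxE det_trig ?unitfE; last first.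
    apply/is_trig_mxP => i j ij; rewrite !mxE; apply/eqP; rewrite f0.
    by apply: sP => //; rewrite inE.
  apply/prodf_neq0 => i _; rewrite !mxE f0.
  by have [] := nqA i.
rewrite -card_ord_pairs_sum -(mxrank_unit Mu) ME.
exact: leq_trans (mxrankM_maxl _ _) (rank_leq_col _).
Qed.

Local Close Scope ring_scope.

(** * Construction of the tower *)

Lemma hitsS (T : finType) (p : T * T) (A B : {set T}) :
  A \subset B -> hits p A -> hits p B.
Proof.
by move=> AB; rewrite /hits => /orP[] /(subsetP AB) ->; rewrite ?orbT.
Qed.

(* Szemeredi and Petruska index by levels: the [s]-th level consists of the
   indices [i] with [s <= #|X i|]. *)
Definition tower (T I : finType) (B X : I -> {set T}) : Prop :=
  (forall i, X i \subset B i) /\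
  (forall i j, i != j -> #|X i| <= #|X j| -> [disjoint X i & B j]).

Lemma tower_extend (T I : finType) (B X : I -> {set T}) (t : nat) (J : {set I})
    (V : {set T}) :
  tower B X -> (forall i, #|X i| <= t) -> {in J, forall i, #|X i| = t} ->
  minset (fun J' : {set I} => V :\: \bigcup_i X i \subset \bigcup_(j in J') B j) J ->
  exists2 X' : I -> {set T}, tower B X' &
    (forall i, #|X' i| = #|X i| + (i \in J)) /\
    (forall i, X i \subset X' i /\ X' i \subset X i :|: (V :\: \bigcup_i X i)).
Proof.
move=> [XB XD] Xt JX /minsetP[Jcov Jmin]; set U := \bigcup_i X i in Jcov Jmin *.
have exY i : exists Y : {set T}, [/\ #|Y| = (i \in J), Y \subset B i,
    Y \subset V :\: U & forall j, j \in J -> j != i -> [disjoint Y & B j]].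
  case: (boolP (i \in J)) => [iJ|_]; last first.
    exists set0; rewrite cards0 !sub0set; split => // j _ _.
    by rewrite -setI_eq0 set0I.
  have : ~~ (V :\: U \subset \bigcup_(j in J :\ i) B j).
    apply/negP => cov; have := Jmin _ cov (subD1set _ _).
    by move/setP/(_ i); rewrite !inE eqxx iJ.
  case/subsetPn => w wVU wJ; exists [set w]; rewrite cards1 !sub1set.
  have wNB j : j \in J -> j != i -> w \notin B j.
    by move=> jJ ji; apply: contra wJ => wB; apply/bigcupP; exists j; rewrite // !inE ji.
  split => // [|j jJ ji]; last by rewrite disjoints1 wNB.
  have /bigcupP[j jJ wj] := subsetP Jcov _ wVU.
  by have [<- //|ji] := eqVneq j i; have := wNB _ jJ ji; rewrite wj.
have [Y YP] := fin_all_exists exY.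
have XYD i : [disjoint X i & Y i].
  have [_ _ YV _] := YP i; rewrite disjoints_subset; apply/subsetP => x xX.
  rewrite inE; apply/negP => /(subsetP YV); rewrite inE => /andP[xU _]; case/negP: xU.
  by apply/bigcupP; exists i.
have cX i : #|X i :|: Y i| = #|X i| + (i \in J).
  have [<- _ _ _] := YP i; rewrite cardsU disjoint_setI0 ?XYD // cards0; lia.
exists (fun i => X i :|: Y i); last first.
  split=> // i; split; first exact: subsetUl.
  by have [_ _ YV _] := YP i; rewrite setUS.
split=> [i|i j ij]; first by rewrite subUset XB; have [_ ->] := YP i.
rewrite !cX; have [cYi _ _ YDi] := YP i; have Xj := Xt j; have Xi := Xt i.
case jJ : (j \in J) => ij_le.
  rewrite -setI_eq0 setIUl setU_eq0 !setI_eq0 XD //=; first by apply: YDi; rewrite // eq_sym.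
  by rewrite (JX j jJ).
have iJ : i \in J = false.
  by apply/negP => iJ; move: ij_le; rewrite iJ (JX i iJ); lia.
rewrite iJ in cYi; move/eqP: cYi; rewrite cards_eq0 => /eqP ->.
by rewrite setU0 XD //; move: ij_le; rewrite iJ; lia.
Qed.

(** Each extension uses up new vertices, so the process ends; extending only along minimal covers
    with at least four members keeps four indices at the top. *)
Lemma tower_exists (T I : finType) (B : I -> {set T}) :
  let V := \bigcup_i B i in
  4 <= #|I| ->
  exists (X : I -> {set T}) (t : nat) (J : {set I}),
  [/\ tower B X, forall i, #|X i| <= t, 4 <= #|[set i | #|X i| == t]|,
      #|J| <= 3 & V :\: \bigcup_i X i \subset \bigcup_(j in J) B j].
Proof.
move=> V I4.
suff H n (X : I -> {set T}) t : #|V :\: \bigcup_i X i| < n ->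
    tower B X -> (forall i, #|X i| <= t) -> 4 <= #|[set i | #|X i| == t]| ->
    V :\: \bigcup_i X i \subset \bigcup_(j in [set i | #|X i| == t]) B j ->
  exists (X : I -> {set T}) (t : nat) (J : {set I}),
  [/\ tower B X, forall i, #|X i| <= t, 4 <= #|[set i | #|X i| == t]|,
      #|J| <= 3 & V :\: \bigcup_i X i \subset \bigcup_(j in J) B j].
  have E : [set i : I | #|(@set0 T)| == 0] = setT.
    by apply/setP => i; rewrite !inE cards0 eqxx.
  apply: (H _ (fun=> set0) 0 (ltnSn _)); rewrite ?E ?cardsT //.
  - split=> i; first exact: sub0set.
    by move=> j _ _; rewrite -setI_eq0 set0I.
  - by move=> i; rewrite cards0.
  - apply/subsetP=> x; rewrite inE => /andP[_ /bigcupP[i _ xi]].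
    by apply/bigcupP; exists i.
elim: n X t => // n IHn X t cV tX Xt top4 cov.
have [J Jmin JX] := @minset_exists _ (fun J : {set I} =>
  V :\: \bigcup_i X i \subset \bigcup_(j in J) B j) _ cov.
have [J3|J4] := leqP #|J| 3.
  by exists X, t, J; split => //; have /minsetP[] := Jmin.
have JXt : {in J, forall i, #|X i| = t}.
  by move=> i /(subsetP JX); rewrite inE => /eqP.
have [X' tX' [cX' XX']] := tower_extend tX Xt JXt Jmin.
have UU' : \bigcup_i X i \subset \bigcup_i X' i.
  by apply/bigcupsP => i _; apply: (bigcup_max i) => //; have [] := XX' i.
have topE : [set i | #|X' i| == t.+1] = J.
  apply/setP => i; rewrite inE cX'; have := Xt i.
  by case iJ : (i \in J); [rewrite (JXt _ iJ) addn1 eqxx | lia].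
apply: (IHn X' t.+1) => //; rewrite ?topE //.
- rewrite ltnS in cV; apply: leq_trans cV; apply: proper_card; rewrite properE setDS //=.
  have /card_gt0P[i iJ] : 0 < #|J| by lia.
  have [Xi X'i] := XX' i.
  have : ~~ (X' i \subset X i).
    apply/negP => /subset_leq_card; rewrite cX' iJ; lia.
  case/subsetPn => x xX' xX; apply/subsetPn; exists x.
    by have := subsetP X'i _ xX'; rewrite inE (negPf xX).
  by rewrite inE negb_and negbK; apply/orP; left; apply/bigcupP; exists i.
- by move=> i; rewrite cX'; have := Xt i; case: (i \in J); lia.
- by apply: subset_trans (setDS _ UU') _; have /minsetP[] := Jmin.
Qed.

(** * Pairs cut out of edges *)

(** An edge avoiding [(B i :\: X i) :|: D] can meet [B i] only inside [X i], so at most two of its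
    vertices lie outside [X i]; as [X i] misses the [B j] in question, these vertices must meet
    them. *)
Lemma free_pair (T I : finType) (B X : I -> {set T}) (m : nat) (i : I)
    (D : {set T}) :
  let V := \bigcup_i B i in
  tower B X -> #|B i| <= m ->
  (forall S : {set T}, S \subset V -> #|V :\: S| < m -> exists2 e : {set T},
     e \subset S /\ #|e| = 3 & forall j, ~~ [disjoint e & B j]) ->
  (exists2 j, j != i & #|X i| <= #|X j|) -> #|D| < #|X i| ->
  exists p : T * T, [/\ (p.1 \in V) && (p.2 \in V), ~~ hits p (B i :|: D) &
    forall j, j != i -> #|X i| <= #|X j| -> hits p (B j)].
Proof.
move=> V [XB XD] Bm edge [j0 j0i Xij0] DX.
set C := (B i :\: X i) :|: D.
have cC : #|C| < m.
  rewrite cardsU; have := cardsDS (XB i); have := subset_leq_card (XB i); lia.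
have [||e [eS e3] eB] := edge (V :\: C); first exact: subsetDl.
  apply: leq_ltn_trans cC; apply: subset_leq_card.
  by rewrite setDDr setDv set0U subsetIr.
have eP z : z \in e :\: X i -> z \in V /\ z \notin B i :|: D.
  rewrite inE => /andP[zX /(subsetP eS)]; rewrite !inE zX /=.
  by case/andP => ? ->.
have ge j : j != i -> #|X i| <= #|X j| -> exists2 z, z \in e :\: X i & z \in B j.
  move=> ji Xij; have := eB j; rewrite -setI_eq0 => /set0Pn[z].
  rewrite inE => /andP[ze zB]; exists z => //; rewrite inE ze andbT.
  have dXB : [disjoint X i & B j] by apply: XD; rewrite // eq_sym.
  by apply/negP => zX; move: zB; rewrite (disjointFr dXB zX).
have g2 : #|e :\: X i| <= 2.
  have := eB i; rewrite -setI_eq0 => /set0Pn[w]; rewrite inE => /andP[we wB].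
  have wX : w \in X i.
    by have := subsetP eS _ we; rewrite !inE wB andbT; case: (w \in X i).
  have : e :\: X i \proper e.
    rewrite properE subsetDl; apply/subsetPn; exists w => //.
    by rewrite inE wX.
  by move/proper_card; rewrite e3.
have [x0 x0g _] := ge _ j0i Xij0.
(* The pair is degenerate, [y0 = x0], if a single vertex remains. *)
have [y0 y0g gE] : exists2 y, y \in e :\: X i & e :\: X i \subset [set x0; y].
  have [sub|] := boolP (e :\: X i \subset [set x0]).
    by exists x0; rewrite // setUid.
  case/subsetPn => y yg yx0; exists y => //.
  suff -> : e :\: X i = [set x0; y] by [].
  apply/esym/eqP; rewrite eqEcard cards2 subUset !sub1set x0g yg.
  by rewrite eq_sym -in_set1 yx0.
exists (x0, y0); split => /=.
- by have [-> _] := eP _ x0g; have [-> _] := eP _ y0g.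
- by rewrite /hits negb_or; have [_ ->] := eP _ x0g; have [_ ->] := eP _ y0g.
move=> j ji Xij; have [z /(subsetP gE)] := ge _ ji Xij.
by rewrite !inE /hits => /orP[] /eqP -> ->; rewrite ?orbT.
Qed.

(** * Popular vertices and skewness *)

Definition popular (T I : finType) (B X : I -> {set T}) (s : nat) : {set T} :=
  [set y in \bigcup_i B i | #|[set p | s <= #|X p| & y \notin B p]| <= 2].

Definition excess (T I : finType) (B X : I -> {set T}) (i : I) : {set T} :=
  popular B X #|X i| :\: B i.

(** The part common to all sets paired with the pairs of [i]; pairs of lower indices are shown to
    meet it. *)
Definition base (T I : finType) (B X : I -> {set T}) (i : I) : {set T} :=
  (B i :\: X i) :|: excess B X i.

(** Trouble arises only if the vertex of [p] in [B j] lies in [X j]. It then misses the other [B q]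
    of at least that level, so the second vertex lies in all of these except possibly [B i], hence
    is popular. *)
Lemma hits_base (T I : finType) (B X : I -> {set T}) (t : nat) (i j : I) (p : T * T) :
  tower B X -> (forall i, #|X i| <= t) -> 4 <= #|[set i | #|X i| == t]| ->
  (p.1 \in \bigcup_i B i) && (p.2 \in \bigcup_i B i) ->
  (forall j, j != i -> #|X i| <= #|X j| -> hits p (B j)) ->
  j != i -> #|X i| <= #|X j| -> hits p (base B X j).
Proof.
move=> [XB XD] Xt top4 pV pB ji Xij.
wlog pj : p pV pB / p.1 \in B j.
  move=> W; have := pB _ ji Xij; case/orP => pj; first exact: W.
  rewrite /hits orbC; apply: (W (p.2, p.1)) => //=; first by rewrite andbC.
  by move=> q qi Xiq; rewrite /hits orbC; apply: pB.
rewrite /hits; case: (boolP (p.1 \in X j)) => pX; last first.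
  by rewrite !inE pj pX.
have p2B q : q != i -> q != j -> #|X j| <= #|X q| -> p.2 \in B q.
  move=> qi qj Xjq; have := pB _ qi (leq_trans Xij Xjq); rewrite /hits.
  by rewrite (disjointFr (XD _ _ _ Xjq) pX) // eq_sym.
have p2Q : p.2 \in popular B X #|X j|.
  case/andP: pV => _ pV; rewrite inE pV /=.
  apply: leq_trans (subset_leq_card (B := [set i; j]) _) _.
    apply/subsetP => q; rewrite !inE => /andP[Xjq].
    by apply: contraR; rewrite negb_or => /andP[qi qj]; apply: p2B.
  by rewrite cards2; case: eqP.
apply/orP; right; rewrite !inE; case: (boolP (p.2 \in B j)) => [_|]; last first.
  by move: p2Q; rewrite inE => ->; rewrite orbT.
(* If [p.2] were in [X j], it would miss three top members and not be popular. *)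
rewrite andbT andFb orbF; apply/negP => p2X.
move: p2Q; rewrite inE => /andP[_]; rewrite leqNgt => /negP; apply.
have -> : 3 = 4 - 1 by [].
rewrite leq_subLR; apply: leq_trans top4 _.
apply: leq_trans (subset_leq_card (B := [set j] :|: _) _) _; last first.
  by rewrite cardsU1; case: (_ \notin _); rewrite // add0n; exact: leqnSn.
apply/subsetP => q; rewrite !inE => /eqP Xq; case: eqVneq => //= qj.
by rewrite Xq Xt /= (disjointFr (XD _ _ _ _) p2X) // ?Xq // eq_sym.
Qed.

(** [D] collects the first vertex of each earlier pair, so sets chosen later meet all earlier
    pairs. *)
Lemma free_pairs (T I : finType) (B X : I -> {set T}) (m : nat) (i : I) (r : nat) :
  let V := \bigcup_i B i in
  tower B X -> #|B i| <= m.+1 ->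
  (forall S : {set T}, S \subset V -> #|V :\: S| < m.+1 -> exists2 e : {set T},
     e \subset S /\ #|e| = 3 & forall j, ~~ [disjoint e & B j]) ->
  (exists2 j, j != i & #|X i| <= #|X j|) -> r + #|excess B X i| <= #|X i| ->
  exists (s : seq ((T * T) * {set T})) (D : {set T}),
  [/\ size s = r, pairwise (fun p q => hits p.1 q.2) s,
      all (fun q => ~~ hits q.1 q.2 && (#|q.2| <= m)) s,
      #|D| <= r /\ {in s, forall q, hits q.1 D} &
      {in s, forall q : (T * T) * {set T}, [/\ (q.1.1 \in V) && (q.1.2 \in V), base B X i \subset q.2 &
        forall j, j != i -> #|X i| <= #|X j| -> hits q.1 (B j)]}].
Proof.
move=> V tX Bm edge exj; elim: r => [|r IHr] rX.
  by exists [::], set0; rewrite cards0.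
have [s [D [ss sP sA [Dr sD] sB]]] := IHr (ltnW rX).
have DX : #|D :|: excess B X i| < #|X i| by rewrite cardsU; lia.
have [p [pV pN pB]] := free_pair tX Bm edge exj DX.
exists (rcons s (p, base B X i :|: D)), (p.1 |: D); split.
- by rewrite size_rcons ss.
- rewrite pairwise_rcons sP andbT; apply/allP => q /sD.
  exact/hitsS/subsetUr.
- rewrite all_rcons sA andbT /=; apply/andP; split.
    apply: contra pN; apply: hitsS; apply/subsetP => x; rewrite !inE.
    by case: (x \in B i); rewrite //= andbF orFb orbC.
  have := (cardsDS (tX.1 i)); have := subset_leq_card (tX.1 i).
  rewrite /base !cardsU; move: DX; rewrite cardsU; lia.
- split; first by rewrite cardsU1; case: (_ \notin _); rewrite ?add0n ?add1n // ltnW.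
  move=> q; rewrite mem_rcons inE => /orP[/eqP -> | /sD].
    by rewrite /hits /= setU11.
  exact/hitsS/subsetUr.
- move=> q; rewrite mem_rcons inE => /orP[/eqP -> | /sB //].
  by split => //=; exact: subsetUl.
Qed.

(** * Counting the pairs and the excess *)

(** Blocks are concatenated by increasing [#|X i|]; [free_pairs] gives skewness inside a block,
    [hits_base] between blocks. *)
Lemma skew_count (T I : finType) (B X : I -> {set T}) (m t : nat) :
  let V := \bigcup_i B i in
  tower B X -> (forall i, #|B i| <= m.+1) ->
  (forall S : {set T}, S \subset V -> #|V :\: S| < m.+1 -> exists2 e : {set T},
     e \subset S /\ #|e| = 3 & forall j, ~~ [disjoint e & B j]) ->
  (forall i, #|X i| <= t) -> 4 <= #|[set i | #|X i| == t]| ->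
  \sum_i (#|X i| - #|excess B X i|) <= 'C(m.+2, 2).
Proof.
move=> V tX Bm edge Xt top4.
have exj i : exists2 j, j != i & #|X i| <= #|X j|.
  have /set0Pn[j] : [set i | #|X i| == t] :\ i != set0.
    by rewrite -card_gt0; move: top4; rewrite (cardsD1 i); lia.
  by rewrite !inE => /andP[ji /eqP Xj]; exists j; rewrite // Xj.
pose le i j := #|X i| <= #|X j|.
have le_tr : transitive le by move=> j i k; apply: leq_trans.
suff [s [ss sP sA _]] : exists s : seq ((T * T) * {set T}),
  [/\ size s = \sum_(i <- sort le (enum I)) (#|X i| - #|excess B X i|),
      pairwise (fun p q => hits p.1 q.2) s,
      all (fun q => ~~ hits q.1 q.2 && (#|q.2| <= m)) s &
      {in s, forall q : (T * T) * {set T}, exists2 i, i \in sort le (enum I) & base B X i \subset q.2}].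
  have := skew_bollobas sA sP; rewrite ss.
  by rewrite (perm_big _ (permEl (perm_sort _ _))) /= big_enum.
have : pairwise le (sort le (enum I)).
  rewrite -sorted_pairwise //; apply: sort_sorted.
  by move=> i j; apply: leq_total.
have : uniq (sort le (enum I)) by rewrite sort_uniq enum_uniq.
elim: (sort _ _) => [_ _|i js IHs] /=.
  by exists [::]; rewrite big_nil.
case/andP=> ijs ujs /andP[ile pjs].
have [s [ss sP sA sB]] := IHs ujs pjs.
have [r [rE rP rA rB]] : exists (s : seq ((T * T) * {set T})),
   [/\ size s = #|X i| - #|excess B X i|, pairwise (fun p q => hits p.1 q.2) s,
      all (fun q => ~~ hits q.1 q.2 && (#|q.2| <= m)) s &
      {in s, forall q : (T * T) * {set T}, [/\ (q.1.1 \in V) && (q.1.2 \in V), base B X i \subset q.2 &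
        forall j, j != i -> #|X i| <= #|X j| -> hits q.1 (B j)]}].
  have [EX|XE] := leqP #|excess B X i| #|X i|; last first.
    by exists [::]; split => //=; lia.
  have [|r [D [? ? ? _ ?]]] := @free_pairs T I B X m i
     (#|X i| - #|excess B X i|) tX (Bm i) edge (exj i).
    by rewrite subnK.
  by exists r.
exists (r ++ s); split.
- by rewrite size_cat big_cons rE ss.
- rewrite pairwise_cat rP sP !andbT; apply/allrelP => p q /rB[pV _ pB] /sB[j jjs jq].
  have ji : j != i by apply: contraNneq ijs => <-.
  exact: hitsS jq (hits_base tX Xt top4 pV pB ji (allP ile _ jjs)).
- by rewrite all_cat rA sA.
- move=> q; rewrite mem_cat => /orP[/rB[_ ? _]|/sB[j jjs ?]].
    by exists i; rewrite ?mem_head.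
  by exists j; rewrite // inE jjs orbT.
Qed.

Lemma card_bigcup_le (T I : finType) (B : I -> {set T}) (J : {set I}) (m : nat) :
  (forall i, #|B i| <= m) -> #|\bigcup_(j in J) B j| <= #|J| * m.
Proof.
move=> Bm; rewrite -sum_nat_const.
elim/big_rec2 : _ => [|j c A _ IH]; first by rewrite cards0.
by apply: leq_trans (leq_card_setU _ _) _; rewrite leq_add.
Qed.

(* A fixed [y] lies in at most two of the sets [excess B X i]: all such [i] are
   counted in the popularity condition for the one with [#|X i|] minimal. *)
Lemma sum_excess (T I : finType) (B X : I -> {set T}) (m t : nat) :
  (forall i, #|B i| <= m) ->
  (forall i, #|X i| <= t) -> 4 <= #|[set i | #|X i| == t]| ->
  \sum_i #|excess B X i| <= 6 * m.
Proof.
move=> Bm Xt top4.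
(* A popular vertex of the top level misses at most two of any three top members, so it lies in
   their union. *)
have popm : #|popular B X t| <= 3 * m.
  have [J JX J3] : exists2 J : {set I}, J \subset [set i | #|X i| == t] & #|J| = 3.
    have /card_gt0P[J] : 0 < #|[set J : {set I} | J \subset [set i | #|X i| == t] & #|J| == 3]|.
      by rewrite cards_draws bin_gt0; lia.
    by rewrite inE => /andP[? /eqP ?]; exists J.
  apply: (@leq_trans #|\bigcup_(j in J) B j|).
    apply/subset_leq_card/subsetP => y; rewrite inE => /andP[_ y2].
    have : ~~ (J \subset [set p | t <= #|X p| & y \notin B p]).
      by apply/negP => /subset_leq_card; rewrite J3 => /leq_trans/(_ y2).
    case/subsetPn => j jJ; have := subsetP JX _ jJ; rewrite !inE => /eqP ->.
    by rewrite leqnn negbK => yB; apply/bigcupP; exists j.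
  by apply: leq_trans (card_bigcup_le _ Bm) _; rewrite J3.
have -> : \sum_i #|excess B X i| =
    \sum_(y : T) #|[set i | y \in excess B X i]|.
  under eq_bigr do rewrite -sum1_card big_mkcond.
  rewrite exchange_big /=; apply: eq_bigr => y _.
  by rewrite -big_mkcond -sum1_card; apply: eq_bigl => i; rewrite inE.
apply: (@leq_trans (\sum_(y in popular B X t) 2)); last first.
  by rewrite sum_nat_const; lia.
rewrite [leqRHS]big_mkcond /=; apply: leq_sum => y _.
have [->|/set0Pn[i0 i0E]] := eqVneq [set i | y \in excess B X i] set0.
  by rewrite cards0.
case: (@arg_minnP _ i0 (mem [set i | y \in excess B X i]) (fun i => #|X i|) i0E) => i iE imin.
have [yV y2] : y \in \bigcup_i B i /\
    #|[set p | #|X i| <= #|X p| & y \notin B p]| <= 2.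
  by move: iE; rewrite /= !inE => /andP[_ /andP].
have -> : y \in popular B X t.
  rewrite inE yV /=; apply: leq_trans y2; apply/subset_leq_card/subsetP => q.
  by rewrite !inE => /andP[/(leq_trans (Xt i)) -> ->].
apply: leq_trans y2; apply/subset_leq_card/subsetP => q qE.
by move: (qE); rewrite !inE imin //= => /andP[].
Qed.

(** * Assembling the bound *)

(** In the [9], six come from [sum_excess] and three from the members covering the vertices outside
    the tower. *)
Lemma union_of_transversals_bound (T I : finType) (B : I -> {set T}) (m : nat) :
  let V := \bigcup_i B i in
  (forall i, #|B i| <= m.+1) ->
  (forall S : {set T}, S \subset V -> #|V :\: S| < m.+1 -> exists2 e : {set T},
     e \subset S /\ #|e| = 3 & forall j, ~~ [disjoint e & B j]) ->
  #|V| <= 'C(m.+2, 2) + 9 * m.+1.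
Proof.
move=> V Bm edge; have [I4|I3] := leqP 4 #|I|; last first.
  have -> : V = \bigcup_(j in [set: I]) B j by apply: eq_bigl => j; rewrite inE.
  apply: leq_trans (card_bigcup_le _ Bm) _; rewrite cardsT; nia.
have [X [t [J [tX Xt top4 J3 cov]]]] := tower_exists B I4.
have cVU : #|V :\: \bigcup_i X i| <= 3 * m.+1.
  apply: leq_trans (subset_leq_card cov) _; apply: leq_trans (card_bigcup_le _ Bm) _.
  by rewrite leq_mul2r J3 orbT.
have cU : #|\bigcup_i X i| <= \sum_i #|X i|.
  elim/big_rec2 : _ => [|j c A _ IH]; first by rewrite cards0.
  by apply: leq_trans (leq_card_setU _ _) _; rewrite leq_add2l.
have sX : \sum_i #|X i| <= \sum_i (#|X i| - #|excess B X i|) + \sum_i #|excess B X i|.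
  by rewrite -big_split /=; apply: leq_sum => i _; lia.
have := skew_count tX Bm edge Xt top4; have := sum_excess Bm Xt top4.
rewrite -(cardsID (\bigcup_i X i) V).
have := subset_leq_card (subsetIr V (\bigcup_i X i)); lia.
Qed.

Local Open Scope ring_scope.

(* Sets N_1..N_l are subsets of a finite ambient type T; V = their union,
   n = #|V|, m = n - k.  The bound is stated in an arbitrary realType R,
   with m^(5/3) and m^(4/3) given by powR. *)
Theorem theorem5 (R : realType) (T : finType) (k l : nat) (N : 'I_l -> {set T}) :
  (3 <= k)%N -> (2 <= l)%N ->
  (forall i, #|N i| = k) ->
  \bigcap_(i < l) N i = finset.set0 ->
  (forall i : 'I_l, \bigcap_(j < l | j != i) N j != finset.set0) ->
  (forall S : {set T}, S \subset \bigcup_(i < l) N i -> (k.+1 <= #|S|)%N ->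
     exists Tr : {set T}, [/\ Tr \subset S, #|Tr| = 3%N &
       forall i : 'I_l, ~~ (Tr \subset N i)]) ->
  let n := #|\bigcup_(i < l) N i| in
  let m : R := (n - k)%N%:R in
  (n%:R : R) <= 'C((n - k).+2, 2)%:R
      + 6 * powR m (5%:R / 3%:R) + 3 * powR m (4%:R / 3%:R) + 9 * m - 3.
Proof.
move=> k3 l2 cN N0 _ edge; cbv zeta.
set V := \bigcup_(i < l) N i in edge *; set n := #|V|; set m : R := (n - k)%:R.
pose B i := V :\: N i.
have NV i : N i \subset V by apply: finset.bigcup_sup.
have BV : \bigcup_i B i = V.
  apply/setP => x; apply/finset.bigcupP/idP => [[i _]|xV].
    by rewrite inE => /andP[].
  have : x \notin \bigcap_(i < l) N i by rewrite N0 inE.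
  have [/existsP[i xi] _|] := boolP [exists i, x \notin N i].
    by exists i; rewrite // inE xi.
  rewrite negb_exists => /forallP Nx /finset.bigcapP[] i _.
  by have := Nx i; rewrite negbK.
have cB i : #|B i| = (n - k)%N by rewrite cardsDS // cN.
have nk : (k <= n)%N by rewrite -(cN (Ordinal (ltnW l2))) subset_leq_card.
have m_gt0 : (0 < n - k)%N.
  rewrite lt0n; apply/eqP => m0.
  suff n0 : n = 0%N by rewrite n0 leqNgt (leq_trans _ k3) in nk.
  apply/eqP; rewrite cards_eq0 -BV; apply/eqP; apply: big1 => i _.
  by apply/eqP; rewrite -cards_eq0 cB m0.
have bound : (n <= 'C((n - k).+1, 2) + 9 * (n - k))%N.
  case Em : (n - k)%N m_gt0 => [//|q] _; rewrite /n -BV.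
  apply: union_of_transversals_bound => [i|S]; first by rewrite cB Em.
  rewrite BV => SV cS.
  have [|e [eS e3 eN]] := edge S SV.
    by have := cardsDS SV; have := subset_leq_card SV; rewrite -/n; lia.
  exists e => // j; apply: contra (eN j) => /disjointFr eB.
  apply/subsetP => x xe; have := eB _ xe; rewrite inE (subsetP SV) ?(subsetP eS) //.
  by rewrite andbT => /negbFE.
have m1 : 1 <= m by rewrite ler1n.
have m53 : m <= powR m (5%:R / 3%:R).
  by rewrite -{1}[m]powRr1 ?ler_powR //; lra.
have m43 : m <= powR m (4%:R / 3%:R).
  by rewrite -{1}[m]powRr1 ?ler_powR //; lra.
have {}bound : n%:R <= 'C((n - k).+1, 2)%:R + 9 * m.
  by rewrite /m -natrM -natrD ler_nat.
(* Passing to ['C((n - k).+2, 2)] gains [m + 1]; with both powers at least [m >= 1] this absorbs the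
   [- 3]. *)
rewrite binS bin1 natrD -natr1 -/m.
by move: bound m1 m53 m43; set x := powR _ _; set y := powR _ _; lra.
Qed.
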